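(* For an integer $n \geq 1$ and $\varepsilon > 0$, let $A^n := \mathbb{R}^n \setminus B_1(0)$ and $l_n := \sqrt{\frac{2(n+1)}{n}}$. The set $\varepsilon \cdot A^n = \{\varepsilon x : x\in A^n\} \subseteq \mathbb{R}^n$ satisfies $$ d_{GH}(\mathbb{R}^n, \varepsilon \cdot A^n) = \frac{l_n}{2}\, d_H(\mathbb{R}^n, \varepsilon \cdot A^n) \quad \text{as well as} \quad d_H(\mathbb{R}^n, \varepsilon \cdot A^n) \leq \varepsilon . $$
   Context: $\mathbb{R}^n$ carries the Euclidean metric, subsets carry the subspace metric, and $B_1(0)$ is the open unit ball. $d_H$ denotes the Hausdorff distance between subsets of $\mathbb{R}^n$. The Gromov--Hausdorff distance is used in its standard, unpointed form for possibly non-compact metric spaces $X$, $Y$: $d_{GH}(X,Y)$ is the infimum of $d_H^Z(X',Y')$ over all metric spaces $Z$ and images $X',Y'\subseteq Z$ of isometric (distance-preserving) embeddings of $X$, $Y$ into $Z$. Equivalently, $d_{GH}(X,Y)=\frac12\inf_R \operatorname{dis}(R)$ over all correspondences $R\subseteq X\times Y$, i.e. relations such that every element of either set is related to some element of the other, where $\operatorname{dis}(R)=\sup\{|d_X(x,x')-d_Y(y,y')| : (x,y),(x',y')\in R\}$. *)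

(* Defs.v *)
From HB Require Import structures.
From mathcomp Require Import all_boot all_order all_algebra.
From mathcomp Require Import all_classical all_reals all_analysis.
From mathcomp Require Import ring.

Set Implicit Arguments.
Unset Strict Implicit.
Unset Printing Implicit Defensive.

Import Order.TTheory GRing.Theory Num.Theory.
Local Open Scope classical_set_scope.
Local Open Scope ring_scope.

(* The library's own metric on 'rV[R]_n is the sup metric; this copy of the
   module 'rV[R]_n carries the Euclidean one instead. *)
Definition euclid (R : realType) (n : nat) : Type := 'rV[R]_n.

HB.instance Definition _ (R : realType) (n : nat) :=
  GRing.Lmodule.copy (euclid R n) 'rV[R]_n.

Definition euclid_dist (R : realType) (n : nat) (x y : euclid R n) : R :=
  Num.sqrt (\sum_(i < n) ((x : 'rV[R]_n) ord0 i - (y : 'rV[R]_n) ord0 i) ^+ 2).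

Lemma cauchy_schwarz_sum (R : realType) (n : nat) (a b : 'I_n -> R) :
  (\sum_i a i * b i) ^+ 2 <= (\sum_i a i ^+ 2) * (\sum_i b i ^+ 2).
Proof.
rewrite -subr_ge0 -(pmulr_rge0 _ (ltr0n R 2)).
have prodE (f g : 'I_n -> R) :
    (\sum_i f i) * (\sum_j g j) = \sum_i \sum_j f i * g j.
  by rewrite mulr_suml; apply: eq_bigr => i _; rewrite mulr_sumr.
have -> (u v w : R) : 2 * (u * v - w ^+ 2) = u * v + v * u - 2 * (w * w) by ring.
rewrite !prodE mulr_sumr -big_split -sumrB /=; apply: sumr_ge0 => i _.
rewrite mulr_sumr -big_split -sumrB /=; apply: sumr_ge0 => j _.
suff -> : a i ^+ 2 * b j ^+ 2 + b i ^+ 2 * a j ^+ 2 - 2 * (a i * b i * (a j * b j))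
    = (a i * b j - a j * b i) ^+ 2 by exact: sqr_ge0.
by ring.
Qed.

Lemma euclid_distxx (R : realType) (n : nat) (x : euclid R n) :
  euclid_dist x x = 0.
Proof.
by rewrite /euclid_dist big1 ?sqrtr0// => i _; rewrite subrr expr0n.
Qed.

Lemma euclid_dist_positivity (R : realType) (n : nat) (x y : euclid R n) :
  euclid_dist x y = 0 -> x = y.
Proof.
move=> /eqP; rewrite sqrtr_eq0 => s0.
have /eqP : \sum_(i < n) ((x : 'rV[R]_n) ord0 i - (y : 'rV[R]_n) ord0 i) ^+ 2
    = 0.
  by apply/eqP; rewrite eq_le s0 sumr_ge0// => i _; exact: sqr_ge0.
rewrite psumr_eq0; last by move=> i _; exact: sqr_ge0.
move=> /allP xy; apply/rowP => i.
by have := xy i (mem_index_enum i); rewrite /= sqrf_eq0 subr_eq0 => /eqP.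
Qed.

Lemma euclid_dist_sym (R : realType) (n : nat) (x y : euclid R n) :
  euclid_dist x y = euclid_dist y x.
Proof.
by congr Num.sqrt; apply: eq_bigr => i _; rewrite -sqrrN opprB.
Qed.

Lemma euclid_dist_triangle (R : realType) (n : nat) (y x z : euclid R n) :
  euclid_dist x z <= euclid_dist x y + euclid_dist y z.
Proof.
have sq_ge0 (f : 'I_n -> R) : 0 <= \sum_i f i ^+ 2.
  by apply: sumr_ge0 => i _; exact: sqr_ge0.
rewrite -(@ler_pXn2r _ 2)// ?nnegrE ?addr_ge0 ?sqrtr_ge0// sqrrD !sqr_sqrtr//.
set a := fun i => (x : 'rV[R]_n) ord0 i - (y : 'rV[R]_n) ord0 i.
set b := fun i => (y : 'rV[R]_n) ord0 i - (z : 'rV[R]_n) ord0 i.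
have -> : \sum_(i < n) ((x : 'rV[R]_n) ord0 i - (z : 'rV[R]_n) ord0 i) ^+ 2
    = \sum_i a i ^+ 2 + (\sum_i a i * b i) *+ 2 + \sum_i b i ^+ 2.
  rewrite -sumrMnl -!big_split /=; apply: eq_bigr => i _.
  by rewrite /a /b; ring.
rewrite lerD2r lerD2l lerMn2r /= -sqrtrM//.
apply: le_trans (ler_norm _) _; rewrite -sqrtr_sqr ler_sqrt ?mulr_ge0//.
exact: cauchy_schwarz_sum.
Qed.

HB.instance Definition _ (R : realType) (n : nat) :=
  isMetric.Build R (euclid R n) (@euclid_distxx R n)
    (@euclid_dist_positivity R n) (@euclid_dist_sym R n)
    (@euclid_dist_triangle R n).

Definition submetric (R : realType) (M : metricType R) (A : set M) : Type :=
  set_type A.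

Section submetric.
Variables (R : realType) (M : metricType R) (A : set M).

HB.instance Definition _ := Choice.copy (submetric A) (set_type A).

Definition submetric_dist (x y : submetric A) : R := mdist (val x) (val y).

Let submetric_distxx x : submetric_dist x x = 0.
Proof. exact: mdistxx. Qed.

Let submetric_dist_positivity x y : submetric_dist x y = 0 -> x = y.
Proof. by move=> /mdist_positivity/val_inj. Qed.

Let submetric_dist_sym x y : submetric_dist x y = submetric_dist y x.
Proof. exact: metric_sym. Qed.

Let submetric_dist_triangle y x z :
  submetric_dist x z <= submetric_dist x y + submetric_dist y z.
Proof. exact: metric_triangle. Qed.

HB.instance Definition _ := isMetric.Build R (submetric A) submetric_distxx
  submetric_dist_positivity submetric_dist_sym submetric_dist_triangle.

End submetric.

(* Extended-real valued: +oo when no r is admissible. *)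
Definition hausdorff_dist (R : realType) (M : metricType R) (A B : set M) :
    \bar R :=
  ereal_inf [set r%:E | r in [set r : R | 0 < r /\
    A `<=` \bigcup_(b in B) ball b r /\ B `<=` \bigcup_(a in A) ball a r]].

Definition isometric (R : realType) (X Z : metricType R) (f : X -> Z) : Prop :=
  forall x y, mdist (f x) (f y) = mdist x y.

Definition gromov_hausdorff_dist (R : realType) (X Y : metricType R) : \bar R :=
  ereal_inf [set d | exists (Z : metricType R) (f : X -> Z) (g : Y -> Z),
    [/\ isometric f, isometric g & d = hausdorff_dist (range f) (range g)]].

Definition ball_compl (R : realType) (n : nat) : set (euclid R n) :=
  ~` ball (0 : euclid R n) 1.

Definition dilate (R : realType) (n : nat) (e : R) (A : set (euclid R n)) :
    set (euclid R n) :=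
  [set e *: x | x in A].

(* The edge length of a regular n-simplex inscribed in the unit sphere. *)
Definition simplex_length (R : realType) (n : nat) : R :=
  Num.sqrt (2 * (n%:R + 1) / n%:R).

(* Main.v *)
(* Upper bound: let l be the edge length of a regular simplex inscribed in the unit
   sphere, so 2 <= l^2 and l <= 2. Send x to itself if |x| >= 1, to x / |x| if
   l / 2 < |x| < 1, and to a simplex vertex v with <x, v> >= 0 if |x| <= l / 2. This
   maps R^n onto the complement of the unit ball and changes distances by at most l,
   so gluing the two spaces along it realises the Gromov-Hausdorff bound l / 2.

   Lower bound: if the two spaces were closer than eps * l / 2, there would be maps
   f : R^n -> A and g : A -> R^n, coarsely inverse to each other, each changing
   distances by less than eps * l. Averaging f and g over fine nets gives continuous F
   and G with F \o G at bounded distance from the identity, so F (G x) = 0 for some x by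
   the Poincare-Miranda theorem. Then 0 is a convex combination of values of f at points
   close to each other; by Caratheodory n + 1 of them suffice, and by Jung's inequality
   two of these values, all of norm at least eps, are at distance at least eps * l, a
   contradiction.

   Poincare-Miranda reduces to a cubical Sperner lemma, which follows from Stokes' formula
   mod 2 for the cubical cup product of the coboundaries of the n sign functions. *)
Require Import Defs.
From HB Require Import structures.
From mathcomp Require Import all_boot all_order all_algebra.
From mathcomp Require Import all_classical all_reals all_analysis.
From mathcomp Require Import ring lra.

Set Implicit Arguments.
Unset Strict Implicit.
Unset Printing Implicit Defensive.

Import Order.TTheory GRing.Theory Num.Theory.
Import numFieldNormedType.Exports.

Local Open Scope classical_set_scope.
Local Open Scope ring_scope.

(** * A cubical Sperner lemma *)

Section CubicalCup.
Variables (I : finType).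
Implicit Types (z : {ffun I -> nat}) (i j : I) (c : {set I}) (b : {ffun I -> nat} -> 'F_2).

Definition upd z i m : {ffun I -> nat} := [ffun k => if k == i then m else z k].
Definition step z i := upd z i (z i).+1.

Lemma F2_addrr (x : 'F_2) : x + x = 0.
Proof. exact: (addrr_pchar2 (pchar_Fp (isT : prime 2))). Qed.

Lemma F2_addNr (x y : 'F_2) : x + (x + y) = y.
Proof. by rewrite addrA F2_addrr add0r. Qed.

(** Each unordered pair of distinct indices is counted twice and so cancels mod 2. The induction
    splits off one element [x], whose row and column cancel. *)
Lemma sum_offdiag_sym c (G : I -> I -> 'F_2) :
  (forall i j, G i j = G j i) ->
  \sum_(i in c) \sum_(j in c :\ i) G i j = 0.
Proof.
move=> Gsym; move: {2}#|c| (erefl #|c|) => m.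
elim: m c => [|m IH] c cm.
  by move/eqP: cm; rewrite cards_eq0 => /eqP ->; rewrite big_set0.
have [x xc] : exists x, x \in c by apply/set0Pn; rewrite -card_gt0 cm.
rewrite (big_setD1 x xc) /=.
rewrite [X in _ + X](eq_bigr (fun i => G x i + \sum_(j in (c :\ x) :\ i) G i j)).
  rewrite big_split /= F2_addNr; apply: IH.
  by move: cm; rewrite (cardsD1 x) xc => -[].
move=> i /setD1P[ix ic]; rewrite (big_setD1 x) /=; last by rewrite !inE eq_sym ix.
by rewrite Gsym; congr (_ + _); apply: eq_bigl => j; rewrite !inE; case: (j == x); case: (j == i).
Qed.

Lemma stepE z i k : step z i k = (z k + (k == i))%N.
Proof. by rewrite ffunE; case: eqP => [->|_]; rewrite ?addn1 ?addn0. Qed.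

Lemma stepC z i j : step (step z i) j = step (step z j) i.
Proof.
by apply/ffunP => k; rewrite !stepE addnAC.
Qed.

(* The value on the cube [z + {0,1}^c] of the cubical cup product of the
   coboundaries of the 0-cochains in [bs], mod 2: a sum over monotone edge paths. *)
Fixpoint cup (bs : seq ({ffun I -> nat} -> 'F_2)) z c : 'F_2 :=
  if bs is b :: bs' then
    \sum_(i in c) (b (step z i) + b z) * cup bs' (step z i) (c :\ i)
  else (c == finset.set0)%:R.

(** A cup product of coboundaries is a cocycle: mod 2, the facets through [z] balance the opposite
    ones. Once the first factor is expanded, the terms symmetric in the two removed directions
    cancel by [sum_offdiag_sym], and the induction hypothesis matches the rest. *)
Lemma cup_closed bs z c : #|c| = (size bs).+1 ->
  \sum_(i in c) cup bs (step z i) (c :\ i) = \sum_(i in c) cup bs z (c :\ i).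
Proof.
elim: bs z c => [|b bs IH] z c /= cs; first by [].
have cD i : i \in c -> #|c :\ i| = (size bs).+1.
  by move=> ic; move: cs; rewrite (cardsD1 i) ic => -[].
have offE (f : I -> I -> 'F_2) :
    \sum_(i in c) \sum_(j in c :\ i) f i j = \sum_(j in c) \sum_(i in c :\ j) f i j.
  rewrite (exchange_big_dep (mem c)) /=; last by move=> i j _ /setD1P[].
  apply: eq_bigr => j jc; apply: eq_bigl => i.
  by rewrite !inE jc andbT eq_sym andbC.
have C2 i j : c :\ i :\ j = c :\ j :\ i by rewrite !finset.setDDl finset.setUC.
have splitE z' i : i \in c ->
    \sum_(j in c :\ i) (b (step z' j) + b z') * cup bs (step z' j) (c :\ i :\ j) =
    \sum_(j in c :\ i) b (step z' j) * cup bs (step z' j) (c :\ i :\ j) +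
    b z' * \sum_(j in c :\ i) cup bs z' (c :\ i :\ j).
  move=> ic; under eq_bigr do rewrite mulrDl.
  by rewrite big_split /= -mulr_sumr IH ?cD.
rewrite (eq_bigr _ (fun i ic => splitE (step z i) i ic)) big_split /=.
rewrite sum_offdiag_sym ?add0r; last by move=> i j; rewrite stepC C2.
rewrite [RHS](eq_bigr _ (fun i ic => splitE z i ic)) big_split /= -mulr_sumr.
rewrite [X in _ = _ + _ * X]sum_offdiag_sym; last by move=> i j; rewrite C2.
rewrite mulr0 addr0 offE; apply: eq_bigr => j jc; rewrite mulr_sumr.
by apply: eq_bigr => i _; rewrite C2.
Qed.

(** As [j] is not a direction of the cube, all its edge paths stay in the hyperplane where the
    coordinate [j] is [v], and the coboundary of [b] vanishes there. *)
Lemma cup_const bs b j (v : nat) (a : 'F_2) z c : b \in (bs : seq _) ->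
  (forall u : {ffun I -> nat}, u j = v -> b u = a) -> j \notin c -> z j = v -> cup bs z c = 0.
Proof.
move=> + bv; elim: bs z c => [//|b' bs IH] z c /=; rewrite inE => /orP[/eqP <-|bbs] jc zj.
  apply: big1 => i ic; rewrite !bv ?F2_addrr ?mul0r// ffunE.
  by case: eqP => // ji; rewrite ji ic in jc.
apply: big1 => i ic; rewrite IH ?mulr0 ?inE ?negb_and ?jc ?orbT//.
by rewrite ffunE; case: eqP => // ji; rewrite ji ic in jc.
Qed.

Lemma cup_neq0 bs b z c : b \in (bs : seq _) -> cup bs z c != 0 ->
  exists u w : {ffun I -> nat}, [/\ forall k, (z k <= u k <= (z k).+1)%N,
    forall k, (z k <= w k <= (z k).+1)%N, b u = 0 & b w = 1].
Proof.
(* Keeping [u] and [w] in the cube spanned by [c] itself is what survives the induction, where the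
   base point moves up in a direction that leaves [c]. *)
suff H : b \in bs -> cup bs z c != 0 ->
  exists u w : {ffun I -> nat}, [/\ forall k, (z k <= u k <= z k + (k \in c))%N,
    forall k, (z k <= w k <= z k + (k \in c))%N, b u = 0 & b w = 1].
  move=> /H{}H /H[u [w [zu zw bu bw]]]; exists u, w; split => // k.
    by case/andP: (zu k) => -> /leq_trans -> //; rewrite -addn1 leq_add2l leq_b1.
  by case/andP: (zw k) => -> /leq_trans -> //; rewrite -addn1 leq_add2l leq_b1.
elim: bs z c => [//|b' bs IH] z c /=; rewrite inE => bbs S0.
have [i ic] : exists2 i, i \in c &
    (b' (step z i) + b' z) * cup bs (step z i) (c :\ i) != 0.
  apply/exists_inP; apply: contraNT S0; rewrite negb_exists_in => /forall_inP S0.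
  by apply/eqP/big1 => i /S0 /negPn/eqP.
rewrite mulf_eq0 negb_or => /andP[bi W0].
have stepI k : (z k <= step z i k <= z k + (k \in c))%N.
  by rewrite ffunE; case: eqP => [->|]; rewrite ?ic ?addn1 ?leqnn ?leqnSn ?leq_addr.
have zI k : (z k <= z k <= z k + (k \in c))%N by rewrite leqnn leq_addr.
case/orP: bbs => [/eqP bb'|bbs].
  have F2P (x : 'F_2) : x = 0 \/ x = 1.
    by case: x => [[|[|//]]] p; [left|right]; apply: val_inj.
  move: bi; rewrite -bb'.
  case: (F2P (b z)) => bz; case: (F2P (b (step z i))) => bs';
    rewrite bz bs' ?F2_addrr ?eqxx // => _.
    by exists z, (step z i).
  by exists (step z i), z.
have [u [w [zu zw bu bw]]] := IH _ _ bbs W0.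
have bd (k : I) (m : nat) : (step z i k <= m <= step z i k + (k \in c :\ i))%N ->
    (z k <= m <= z k + (k \in c))%N.
  rewrite !inE ffunE; case: eqVneq => [->|_] /=; last by [].
  by rewrite ic addn0 addn1 => /andP[zm ->]; rewrite (ltnW zm).
by exists u, w; split => // k; apply: bd.
Qed.

(** * Sums over boxes of lattice points, and Stokes' formula *)

Variable N : nat.

Definition boxsum (l : seq I) (F : {ffun I -> nat} -> 'F_2) : {ffun I -> nat} -> 'F_2 :=
  foldr (fun i G z => \sum_(m < N) G (upd z i m)) F l.

Lemma eq_boxsum l F G z : (forall u, F u = G u) -> boxsum l F z = boxsum l G z.
Proof. by move=> FG; elim: l z => [|i l IH] z //=; apply: eq_bigr => m _. Qed.

Lemma boxsum_sum l (J : finType) (P : pred J) F z :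
  boxsum l (fun u => \sum_(j | P j) F j u) z = \sum_(j | P j) boxsum l (F j) z.
Proof.
elim: l z => [|i l IH] z //=; under eq_bigr do rewrite IH.
by rewrite exchange_big.
Qed.

Lemma updC z i j m k : i != j -> upd (upd z i m) j k = upd (upd z j k) i m.
Proof.
move=> ij; apply/ffunP => x; rewrite !ffunE.
by case: (eqVneq x j) => // ->; rewrite eq_sym (negbTE ij).
Qed.

Lemma boxsum_rem l i F z : i \in l -> uniq l ->
  boxsum l F z = \sum_(m < N) boxsum (rem i l) F (upd z i m).
Proof.
elim: l z => [//|j l IH] z; rewrite inE /= => il /andP[jl ul].
have [->//|ij] := eqVneq j i.
move: il; rewrite eq_sym (negbTE ij) /= => il.
under eq_bigr do rewrite IH//; rewrite exchange_big /=.
by apply: eq_bigr => m _; apply: eq_bigr => k _; rewrite updC.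
Qed.

Lemma boxsum_upd l i F m z : i \notin l ->
  boxsum l F (upd z i m) = boxsum l (fun u => F (upd u i m)) z.
Proof.
elim: l z => [//|j l IH] z; rewrite inE /= negb_or => /andP[ij il].
by apply: eq_bigr => k _; rewrite updC// IH.
Qed.

Lemma upd_upd z i m k : upd (upd z i m) i k = upd z i k.
Proof. by apply/ffunP => x; rewrite !ffunE; case: eqP. Qed.

Lemma boxsumD l F G z : boxsum l (fun u => F u + G u) z = boxsum l F z + boxsum l G z.
Proof.
elim: l z => [|i l IH] z //=; under eq_bigr do rewrite IH.
by rewrite big_split.
Qed.

(** Mod 2 every slice strictly between the two end faces occurs twice. *)
Lemma boxsum_telescope l i F z : i \in l -> uniq l ->
  boxsum l (fun u => F (step u i) + F u) z =
  boxsum (rem i l) F (upd z i N) + boxsum (rem i l) F (upd z i 0).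
Proof.
move=> il ul; have il' : i \notin rem i l by rewrite mem_rem_uniqF.
rewrite (boxsum_rem _ _ il ul).
pose a m := boxsum (rem i l) F (upd z i m).
rewrite (eq_bigr (fun m : 'I_N => a m.+1 + a m)); last first.
  move=> m _; rewrite boxsumD; congr (_ + _).
  rewrite /a !boxsum_upd//; apply: eq_boxsum => u.
  by rewrite /step upd_upd ffunE eqxx.
rewrite -/(a N) -/(a 0); elim: (N) => [|k IH]; first by rewrite big_ord0 F2_addrr.
by rewrite big_ord_recr /= IH addrC -addrA F2_addNr.
Qed.

Lemma boxsum_eq0 l F z : (forall u, F u = 0) -> boxsum l F z = 0.
Proof. by move=> F0; elim: l z => [|i l IH] z //=; rewrite big1. Qed.

Lemma boxsum_neq0 l F z : boxsum l F z != 0 ->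
  exists2 u, F u != 0 & forall i, i \in l -> (u i < N)%N.
Proof.
move=> H; suff [u Fu [ul _]] : exists2 u, F u != 0 &
    (forall i, i \in l -> (u i < N)%N) /\ (forall i, i \notin l -> u i = z i).
  by exists u.
elim: l z H => [|i l IH] z /= H; first by exists z.
have [m Hm] : exists m : 'I_N, boxsum l F (upd z i m) != 0.
  apply/existsP; apply: contraNT H; rewrite negb_exists => /forallP H.
  by apply/eqP/big1 => m _; apply/eqP/negPn/H.
have [u Fu [ul unl]] := IH _ Hm; exists u => //; split=> k; rewrite inE.
  case: (boolP (k \in l)) => [/ul//|kl]; rewrite orbF => /eqP ki.
  by rewrite unl// ki ffunE eqxx.
by rewrite negb_or => /andP[ki kl]; rewrite unl// ffunE (negbTE ki).
Qed.

Variable bv : I -> {ffun I -> nat} -> 'F_2.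
Hypothesis bv0 : forall i (u : {ffun I -> nat}), u i = 0 -> bv i u = 0.
Hypothesis bvN : forall i (u : {ffun I -> nat}), u i = N -> bv i u = 1.

Arguments boxsum : simpl never.

(* Stokes' formula for [b_j \cup d b_i1 \cup d b_i2 ...]: on a face [z i = 0] or [z i = N]
   with [i <> j] some [d b_i] vanishes, and [b_j] vanishes on [z j = 0], so only the face
   [z j = N] contributes, where [b_j = 1]. *)
Lemma boxsum_cup l z : uniq l ->
  boxsum l (fun u => cup (map bv l) u [set i in l]%SET) z = 1.
Proof.
elim: l z => [|j l IH] z; first by rewrite /boxsum /= (_ : _ == _) //;
  apply/eqP/setP => i; rewrite !inE.
rewrite cons_uniq => /andP[jl ul]; set c := [set i in _]%SET.
have inc i : (i \in c) = (i \in j :: l) by rewrite inE.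
have cj : c :\ j = [set i in l]%SET.
  apply/setP => i; rewrite !inE.
  by case: eqVneq => [->|]//=; rewrite (negbTE jl).
have cc : #|c| = (size (map bv l)).+1.
  by rewrite (cardsD1 j) inc mem_head cj size_map cardsE; congr (_.+1); apply/card_uniqP.
pose X i u := bv j u * cup (map bv l) u (c :\ i).
(* Expanding the coboundary of [bv j] and moving its second half to the facets through [u] by
   [cup_closed] turns the integrand into a sum of differences, one for each direction, ready to
   telescope. *)
transitivity (boxsum (j :: l) (fun u => \sum_(i in c) (X i (step u i) + X i u)) z).
  apply: eq_boxsum => u /=; under eq_bigr do rewrite mulrDl.
  by rewrite big_split /= -mulr_sumr (cup_closed _ cc) mulr_sumr -big_split.
rewrite boxsum_sum (big_only1 j) ?inc ?mem_head//; last first.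
  move=> i ij ic; have il : i \in l by move: ic; rewrite inc inE (negbTE ij).
  have il' : i \notin rem i (j :: l) by rewrite mem_rem_uniqF// cons_uniq jl.
  rewrite boxsum_telescope ?cons_uniq ?jl// -?inc//.
  have X0 m a : (forall u : {ffun I -> nat}, u i = m -> bv i u = a) ->
      boxsum (rem i (j :: l)) (X i) (upd z i m) = 0.
    move=> ba; rewrite boxsum_upd//; apply: boxsum_eq0 => u.
    by rewrite /X (cup_const (map_f bv il) ba) ?mulr0 ?inE ?eqxx// ffunE eqxx.
  by rewrite (X0 _ _ (@bvN i)) (X0 _ _ (@bv0 i)) addr0.
rewrite boxsum_telescope ?mem_head ?cons_uniq ?jl//= eqxx.
rewrite [X in _ + X](_ : _ = 0) ?addr0; last first.
  rewrite boxsum_upd//; apply: boxsum_eq0 => u.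
  by rewrite /X bv0 ?mul0r// ffunE eqxx.
rewrite -(IH (upd z j N) ul) !boxsum_upd//; apply: eq_boxsum => u.
by rewrite /X bvN ?mul1r ?cj// ffunE eqxx.
Qed.

(** The cup products sum to 1 over the box, so some cube has a nonzero one. Every [bv i] is a factor
    of it and therefore changes along an edge of that cube. *)
Lemma cube_sign_change : exists z : {ffun I -> nat}, (forall i, (z i < N)%N) /\
  forall i, exists u w : {ffun I -> nat}, [/\ forall k, (z k <= u k <= (z k).+1)%N,
    forall k, (z k <= w k <= (z k).+1)%N, bv i u = 0 & bv i w = 1].
Proof.
have s1 := boxsum_cup [ffun => 0%N] (enum_uniq I).
have /boxsum_neq0[z zc zN] := etrans (congr1 (fun x => x != 0) s1) (@oner_neq0 'F_2).
exists z; split=> i; first by apply: zN; rewrite mem_enum.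
by apply: (cup_neq0 _ zc); apply: map_f; rewrite mem_enum.
Qed.
End CubicalCup.

(** * The Poincare-Miranda theorem *)

(** Ever finer grids, labelled by the signs of the coordinates of [H], contain cells in which every
    coordinate takes both labels. At a cluster point of these cells some coordinate of [H] would be
    nonzero, hence of constant sign on a whole nearby cell. *)
Lemma poincare_miranda (R : realType) (n : nat) (H : 'rV[R]_n -> 'rV[R]_n) (L : R) :
  0 < L ->
  (forall x : 'rV[R]_n, (forall i, `|x ord0 i| <= L) -> {for x, continuous H}) ->
  (forall (x : 'rV[R]_n) i, (forall i, `|x ord0 i| <= L) -> x ord0 i = - L -> H x ord0 i <= 0) ->
  (forall (x : 'rV[R]_n) i, (forall i, `|x ord0 i| <= L) -> x ord0 i = L -> 0 <= H x ord0 i) ->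
  exists2 x : 'rV[R]_n, (forall i, `|x ord0 i| <= L) & H x = 0.
Proof.
move=> L0 Hc HN HP; apply: contrapT => noz.
have nz (x : 'rV[R]_n) : (forall i, `|x ord0 i| <= L) -> exists i, H x ord0 i != 0.
  move=> xL; apply: contrapT => Hx; apply: noz; exists x => //.
  apply/rowP => i; rewrite mxE; apply/eqP/negPn/negP => Hi.
  by apply: Hx; exists i.
pose pt (k : nat) (u : {ffun 'I_n -> nat}) : 'rV[R]_n :=
  \row_i (- L + 2 * L * (u i)%:R / k.+1%:R).
have ptL k (u : {ffun 'I_n -> nat}) : (forall i, (u i <= k.+1)%N) ->
    forall i, `|pt k u ord0 i| <= L.
  move=> uk i; rewrite mxE ler_norml.
  have : 0 <= (u i)%:R / k.+1%:R :> R by rewrite divr_ge0.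
  have : (u i)%:R / k.+1%:R <= 1 :> R by rewrite ler_pdivrMr ?ltr0n// mul1r ler_nat.
  rewrite -mulrA; set t := _ / _; move=> t1 t0; apply/andP; split; nra.
(* On the two faces orthogonal to [i] the label is imposed, whatever [H] does, because
   [cube_sign_change] requires exact boundary values and [H] may vanish there. *)
pose b k i (u : {ffun 'I_n -> nat}) : 'F_2 :=
  if u i == 0%N then 0 else if u i == k.+1 then 1 else ((0 < H (pt k u) ord0 i)%R : nat)%:R.
have /choice[z /all_and2[zk zP]] : forall k, exists z : {ffun 'I_n -> nat},
    (forall i, (z i < k.+1)%N) /\
    forall i, exists u w : {ffun 'I_n -> nat}, [/\ forall k, (z k <= u k <= (z k).+1)%N,
      forall k, (z k <= w k <= (z k).+1)%N, b k i u = 0 & b k i w = 1].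
  move=> k; apply: cube_sign_change => i u ui; rewrite /b ui eqxx//.
pose xs k := pt k (z k).
have [x []] : [set v : 'rV[R]_n | forall i, v ord0 i \in `[- L, L]] `&`
    cluster (xs @ \oo) !=set0.
  apply: (@rV_compact _ _ (fun=> `[- L, L]%classic)); first by move=> _; apply: segment_compact.
  exists 0%N => // k _ i /=; rewrite in_itv/= -ler_norml.
  by apply: ptL => j; apply: ltnW.
move=> xL0 xcl.
have xL i : `|x ord0 i| <= L by move: (xL0 i); rewrite /= in_itv /= -ler_norml.
have [i Hi] := nz x xL.
have Hic : {for x, continuous (fun y => H y ord0 i)}.
  apply: (@continuous_comp _ _ _ H (fun M : 'rV[R]_n => M ord0 i)); first exact: Hc.
  exact: coord_continuous.
(* Half of [e] is for the distance from [x] to the base point of the cell, half for the mesh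
   [2 * L / k.+1]. *)
have cell e : 0 < e -> exists k, forall u : {ffun 'I_n -> nat},
    (forall j, (z k j <= u j <= (z k j).+1)%N) -> ball x e (pt k u).
  move=> e0; have e20 : 0 < e / 2 by rewrite divr_gt0.
  have [K _ KP] : \forall k \near \oo, 2 * L / k.+1%:R < e / 2.
    have := @cvg_harmonic R; move=> /cvgrPdist_lt /(_ (e / 2 / (2 * L))).
    rewrite !divr_gt0 ?mulr_gt0// => /(_ isT); apply: filterS => k.
    rewrite sub0r normrN ger0_norm ?invr_ge0// ltr_pdivlMr ?mulr_gt0//.
    by rewrite mulrC.
  have FA : (xs @ \oo) (xs @` [set k | (K <= k)%N]) by exists K => // k Kk; exists k.
  have [_ [[k /= Kk <-] xk]] := xcl _ _ FA (nbhsx_ballx x _ e20).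
  exists k => u uz; have [_ xkb] := xk; split => // a j.
  rewrite (splitr e); apply: (ball_triangle (xkb _ _)); rewrite /ball /= !mxE.
  have /andP[zu uz1] := uz j.
  apply: (le_lt_trans _ (KP k Kk)).
  have -> : - L + 2 * L * (z k j)%:R / k.+1%:R - (- L + 2 * L * (u j)%:R / k.+1%:R) =
     - (2 * L / k.+1%:R * ((u j)%:R - (z k j)%:R)) by ring.
  rewrite -natrB// normrN normrM ger0_norm ?divr_ge0 ?mulr_ge0 ?(ltW L0)//.
  rewrite [`|(_ - _)%:R|]ger0_norm ?ler0n// ler_piMr ?divr_ge0 ?mulr_ge0 ?(ltW L0)//.
  by rewrite -[1]/(1%:R) ler_nat leq_subLR addn1.
have cell_le (k : nat) (u : {ffun 'I_n -> nat}) j :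
    (forall j, (z k j <= u j <= (z k j).+1)%N) -> (u j <= k.+1)%N.
  by move=> uz; have /andP[_ /leq_trans] := uz j; apply; apply: zk.
move: Hi; rewrite neq_lt => /orP[Hi|Hi].
(* The vertex [w] labelled 1 either has a positive value of [H] or lies on the upper face, where
   [HP] applies; both contradict the negative sign near [x]. The other case is symmetric, with [u]
   and [HN]. *)
- have /nbhs_ballP[e /= e0 He] : \forall y \near x, H y ord0 i < 0.
    exact: (cvgr_lt _ Hic).
  have [k kP] := cell e e0; have [_ [w [_ wz _]]] := zP k i.
  have := He _ (kP w wz); rewrite /= /b => Hw.
  case: eqP => // _; case: eqP => [wk|_]; last by rewrite ltNge (ltW Hw).
  move=> _; have : 0 <= H (pt k w) ord0 i.
    apply: HP; first by apply: ptL => j; apply: cell_le.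
    by rewrite mxE wk mulfK//; ring.
  by rewrite leNgt Hw.
- have /nbhs_ballP[e /= e0 He] : \forall y \near x, 0 < H y ord0 i.
    exact: (cvgr_gt _ Hic).
  have [k kP] := cell e e0; have [u [_ [uz _ + _]]] := zP k i.
  have := He _ (kP u uz); rewrite /= /b => Hu.
  case: eqP => [uk _|_]; last by case: eqP => // _; rewrite Hu.
  have : H (pt k u) ord0 i <= 0.
    apply: HN; first by apply: ptL => j; apply: cell_le.
    by rewrite mxE uk mulr0 mul0r addr0.
  by rewrite leNgt Hu.
Qed.

(** * Euclidean geometry *)

Section Dot.
Variables (R : realType) (n : nat).
Implicit Types (x y z : 'rV[R]_n) (a : R).

Definition dot x y : R := \sum_i x ord0 i * y ord0 i.
Definition enorm x : R := Num.sqrt (dot x x).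

Lemma dotC x y : dot x y = dot y x.
Proof. by apply: eq_bigr => i _; rewrite mulrC. Qed.

Lemma dotDl x y z : dot (x + y) z = dot x z + dot y z.
Proof. by rewrite -big_split; apply: eq_bigr => i _; rewrite mxE mulrDl. Qed.

Lemma dotZl a x z : dot (a *: x) z = a * dot x z.
Proof. by rewrite mulr_sumr; apply: eq_bigr => i _; rewrite mxE mulrA. Qed.

Lemma dotNl x z : dot (- x) z = - dot x z.
Proof. by rewrite -scaleN1r dotZl mulN1r. Qed.

Lemma dotDr x y z : dot x (y + z) = dot x y + dot x z.
Proof. by rewrite dotC dotDl !(dotC x). Qed.

Lemma dotZr a x z : dot x (a *: z) = a * dot x z.
Proof. by rewrite dotC dotZl dotC. Qed.

Lemma dotNr x z : dot x (- z) = - dot x z.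
Proof. by rewrite dotC dotNl dotC. Qed.

Lemma dot0l z : dot 0 z = 0.
Proof. by rewrite -(scale0r 0) dotZl mul0r. Qed.

Lemma dot_suml (J : finType) (P : pred J) (F : J -> 'rV[R]_n) z :
  dot (\sum_(j | P j) F j) z = \sum_(j | P j) dot (F j) z.
Proof. by elim/big_rec2: _ => [|j u v _ <-]; rewrite ?dot0l// dotDl. Qed.

Lemma dot_sumr (J : finType) (P : pred J) (F : J -> 'rV[R]_n) z :
  dot z (\sum_(j | P j) F j) = \sum_(j | P j) dot z (F j).
Proof. by rewrite dotC dot_suml; apply: eq_bigr => j _; rewrite dotC. Qed.

Lemma dot_ge0 x : 0 <= dot x x.
Proof. by apply: sumr_ge0 => i _; rewrite -expr2 sqr_ge0. Qed.

Lemma dot_subsub x y : dot (x - y) (x - y) = dot x x - 2 * dot x y + dot y y.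
Proof. by rewrite !(dotDl, dotDr, dotNl, dotNr) (dotC y x); ring. Qed.

Lemma enorm_ge0 x : 0 <= enorm x. Proof. exact: sqrtr_ge0. Qed.

Lemma sqr_enorm x : enorm x ^+ 2 = dot x x.
Proof. by rewrite sqr_sqrtr ?dot_ge0. Qed.

Lemma euclid_distE (x y : euclid R n) : euclid_dist x y = enorm ((x : 'rV[R]_n) - y).
Proof. by congr Num.sqrt; apply: eq_bigr => i _; rewrite !mxE expr2. Qed.

Lemma enormB_triangle y x z : enorm (x - z) <= enorm (x - y) + enorm (y - z).
Proof. by rewrite -!(euclid_distE (_ : euclid R n)) euclid_dist_triangle. Qed.

Lemma enormN x : enorm (- x) = enorm x.
Proof. by rewrite /enorm dotNl dotNr opprK. Qed.

Lemma enormB x y : enorm (x - y) = enorm (y - x).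
Proof. by rewrite -opprB enormN. Qed.

Lemma enormD x y : enorm (x + y) <= enorm x + enorm y.
Proof. by have := enormB_triangle 0 x (- y); rewrite !opprK subr0 add0r. Qed.

Lemma enorm0 : enorm 0 = 0.
Proof. by rewrite /enorm dot0l sqrtr0. Qed.

Lemma enormZ a x : enorm (a *: x) = `|a| * enorm x.
Proof. by rewrite /enorm dotZl dotZr mulrA -expr2 sqrtrM ?sqr_ge0// sqrtr_sqr. Qed.

Lemma enorm_eq0 x : enorm x = 0 -> x = 0.
Proof.
move=> x0; apply: (@euclid_dist_positivity R n x 0).
by rewrite euclid_distE subr0.
Qed.

Lemma enorm_sum (J : finType) (P : pred J) (F : J -> 'rV[R]_n) :
  enorm (\sum_(j | P j) F j) <= \sum_(j | P j) enorm (F j).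
Proof.
elim/big_rec2: _ => [|j u v _ IH]; first by rewrite enorm0.
by apply: (le_trans (enormD _ _)); rewrite lerD2l.
Qed.

Lemma coord_le_enorm x i : `|x ord0 i| <= enorm x.
Proof.
rewrite -sqrtr_sqr ler_sqrt ?dot_ge0// /dot (bigD1 i) //= -expr2 lerDl.
by apply: sumr_ge0 => j _; rewrite -expr2 sqr_ge0.
Qed.

Lemma enorm_le_coord x a : (forall i, `|x ord0 i| <= a) -> enorm x <= n%:R * a.
Proof.
move=> xa; have -> : x = \sum_i x ord0 i *: delta_mx ord0 i.
  by rewrite [LHS]row_sum_delta.
apply: (le_trans (enorm_sum _ _)).
rewrite -[n in n%:R]card_ord mulr_natl -sumr_const; apply: ler_sum => i _.
rewrite enormZ (_ : enorm _ = 1) ?mulr1//.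
rewrite /enorm /dot (bigD1 i)//= !mxE !eqxx big1 ?addr0 ?mulr1 ?sqrtr1// => j ji.
by rewrite !mxE (negbTE ji) andbF mul0r.
Qed.

(** * Convex combinations: the theorems of Caratheodory and Jung *)

Lemma enorm_convex (J : finType) (lam : J -> R) (q : J -> 'rV[R]_n) c D :
  (forall j, 0 <= lam j) -> \sum_j lam j = 1 ->
  (forall j, 0 < lam j -> enorm (q j - c) <= D) ->
  enorm (\sum_j lam j *: q j - c) <= D.
Proof.
move=> lam0 lam1 qD.
have -> : \sum_j lam j *: q j - c = \sum_j lam j *: (q j - c).
  under [RHS]eq_bigr do rewrite scalerBr.
  by rewrite sumrB -scaler_suml lam1 scale1r.
apply: (le_trans (enorm_sum _ _)); rewrite -[leRHS]mul1r -lam1 mulr_suml.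
apply: ler_sum => j _; rewrite enormZ ger0_norm//.
have := lam0 j; rewrite le_eqVlt => /orP[/eqP<-|lj]; first by rewrite !mul0r.
by rewrite ler_pM2l// qD.
Qed.

(** More than [n + 1] points are affinely dependent; moving the weights along a dependence until the
    first of them vanishes shrinks the support. *)
Lemma caratheodory (J : finType) (lam : J -> R) (q : J -> 'rV[R]_n) :
  (forall j, 0 <= lam j) -> \sum_j lam j = 1 -> \sum_j lam j *: q j = 0 ->
  exists mu : J -> R, [/\ forall j, 0 <= mu j, \sum_j mu j = 1,
    \sum_j mu j *: q j = 0, forall j, 0 < mu j -> 0 < lam j &
    (#|[pred j | (mu j != 0)%R]| <= n.+1)%N].
Proof.
have [m] := ubnP #|[pred j | (lam j != 0)%R]|; elim: m lam => // m IH lam.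
rewrite ltnS => cm lam0 lam1 lamq.
have [cn|cn] := leqP #|[pred j | (lam j != 0)%R]| n.+1; first by exists lam.
set S := [pred j | (lam j != 0)%R] in cm cn.
(* The extra column of ones makes a kernel vector an affine dependence: its coefficients also sum to
   zero. *)
pose A : 'M[R]_(#|S|, (n + 1)%N) := \matrix_k row_mx (q (enum_val k)) (1%:M : 'M[R]_1).
pose v := nz_row (kermx A).
have v0 : v != 0.
  rewrite nz_row_eq0 kermx_eq0 /row_free neq_ltn.
  by rewrite (leq_ltn_trans (rank_leq_col A))// addn1.
have vA : v *m A = 0 by apply/sub_kermxP/nz_row_sub.
have [vq v1] : \sum_k v ord0 k *: q (enum_val k) = 0 /\ \sum_k v ord0 k = 0.
  rewrite mulmx_sum_row in vA; split.
    move/(congr1 lsubmx): vA; rewrite linear_sum linear0 /= => E.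
    by rewrite -[RHS]E; apply: eq_bigr => k _; rewrite rowK scale_row_mx row_mxKl.
  move/(congr1 (fun M => rsubmx M ord0 ord0)): vA; rewrite linear_sum summxE !mxE => E.
  rewrite -[RHS]E; apply: eq_bigr => k _.
  by rewrite /= rowK scale_row_mx row_mxKr !mxE mulr1.
pose mu j := \sum_(k | enum_val k == j) v ord0 k.
have muE (V : lmodType R) (f : J -> V) :
    \sum_j mu j *: f j = \sum_k v ord0 k *: f (enum_val k).
  rewrite [RHS](partition_big enum_val predT)//=; apply: eq_bigr => j _.
  by rewrite scaler_suml; apply: eq_bigr => k /eqP ->.
have mu_val k : mu (enum_val k) = v ord0 k.
  rewrite /mu (big_pred1 k)// => k'; exact: (inj_eq enum_val_inj).
have muS j : j \notin S -> mu j = 0.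
  move=> jS; rewrite /mu big_pred0// => k; apply: contraNF jS => /eqP <-.
  exact: enum_valP.
have mu1 : \sum_j mu j = 0.
  transitivity (\sum_j mu j *: (1 : R^o)); first by apply: eq_bigr => j _; rewrite [RHS]mulr1.
  by rewrite muE -[RHS]v1; apply: eq_bigr => k _; rewrite [LHS]mulr1.
have [i0 i0P] : exists i, 0 < mu i.
  apply/not_existsP => mule; have /rV0Pn[k] := v0; apply/negP/negPn.
  have muN : \sum_j - mu j == 0 by rewrite sumrN mu1 oppr0.
  rewrite psumr_eq0 in muN; last first.
    by move=> j _; rewrite oppr_ge0 leNgt; apply/negP/mule.
  by move: (allP muN (enum_val k) (mem_index_enum _)); rewrite /= oppr_eq0 mu_val.
(* The least ratio [lam j / mu j] is the largest multiple of [mu] that can be subtracted with all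
   weights staying nonnegative; it kills the weight at [i1]. *)
case: (@arg_minP _ _ _ i0 (fun i => 0 < mu i) (fun j => lam j / mu j) i0P) => i1 mi1 i1min.
pose t := lam i1 / mu i1.
have t0 : 0 <= t by rewrite divr_ge0// ltW.
have SP j : mu j != 0 -> lam j != 0 by apply: contraNN => /negPn/muS ->.
have [||||nu [nu0 nu1 nuq nus nuc]] := IH (fun j => lam j - t * mu j).
- apply: leq_trans cm; rewrite [X in (_ < X)%N](cardD1 i1) -[i1 \in S]/(lam i1 != 0) SP ?gt_eqF//.
  rewrite add1n ltnS; apply/subset_leq_card/fintype.subsetP => j; rewrite !inE => lj.
  apply/andP; split.
    by apply: contraNneq lj => ->; rewrite /t divfK ?subrr// gt_eqF.
  by apply: contraNN lj => lj; rewrite (eqP lj) muS ?mulr0 ?subr0// inE negbK.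
- move=> j; rewrite subr_ge0; have [mj|mj] := ltP 0 (mu j).
    by rewrite -ler_pdivlMr//; apply: i1min.
  by apply: le_trans (lam0 j); rewrite mulr_ge0_le0.
- by rewrite sumrB -mulr_sumr mu1 mulr0 subr0.
- under eq_bigr do rewrite scalerBl -scalerA.
  by rewrite sumrB -scaler_sumr muE vq lamq scaler0 subr0.
exists nu; split => // j /nus lj; rewrite lt_neqAle lam0 andbT eq_sym.
apply: contraTneq lj => lj; rewrite lj muS ?mulr0 ?subr0 ?ltxx// inE negbK.
exact/eqP.
Qed.

(* After Caratheodory, average [|q i - q j| ^ 2] against [mu i * mu j]: the diagonal
   carries no distance but mass [\sum_i mu i ^ 2 >= 1 / (n + 1)]. *)
Lemma jung (J : finType) (lam : J -> R) (q : J -> 'rV[R]_n) (r D : R) : 0 <= r ->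
  (forall j, 0 <= lam j) -> \sum_j lam j = 1 -> \sum_j lam j *: q j = 0 ->
  (forall j, 0 < lam j -> r <= enorm (q j)) ->
  (forall i j, 0 < lam i -> 0 < lam j -> enorm (q i - q j) <= D) ->
  2 * (n%:R + 1) * r ^+ 2 <= n%:R * D ^+ 2.
Proof.
move=> r0 lam0 lam1 lamq qr qD.
have [mu [mu0 mu1 muq mulam cmu]] := caratheodory lam0 lam1 lamq.
have mupos j : (mu j == 0) || (0 < mu j) by have := mu0 j; rewrite le_eqVlt eq_sym.
(* The cross terms vanish because the barycentre of the [q i] is the origin. *)
have sqE : \sum_i \sum_j mu i * mu j * dot (q i - q j) (q i - q j) =
    2 * \sum_i mu i * dot (q i) (q i).
  transitivity (\sum_i (mu i * dot (q i) (q i) * \sum_j mu j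
      - 2 * dot (mu i *: q i) (\sum_j mu j *: q j)
      + mu i * \sum_j mu j * dot (q j) (q j))).
    apply: eq_bigr => i _.
    rewrite (eq_bigr (fun j => mu i * dot (q i) (q i) * mu j - 2 * dot (mu i *: q i) (mu j *: q j)
        + mu i * (mu j * dot (q j) (q j)))); last first.
      by move=> j _; rewrite dot_subsub dotZl dotZr; ring.
    by rewrite big_split sumrB -!mulr_sumr -dot_sumr.
  rewrite big_split /= -mulr_suml mu1 mul1r muq.
  under eq_bigr do rewrite (dotC _ 0) dot0l mulr0 subr0 mulr1.
  ring.
have lo : 2 * r ^+ 2 <= \sum_i \sum_j mu i * mu j * dot (q i - q j) (q i - q j).
  rewrite sqE ler_pM2l// -[leLHS]mul1r -mu1 mulr_suml; apply: ler_sum => i _.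
  case/orP: (mupos i) => [/eqP ->|mi]; first by rewrite !mul0r.
  rewrite ler_pM2l// -sqr_enorm lerXn2r ?nnegrE ?enorm_ge0//.
  exact/qr/mulam.
have D0 : 0 <= D.
  have [j mj] : exists j, 0 < mu j.
    apply/not_existsP => H; have := oner_neq0 R; rewrite -mu1 big1 ?eqxx// => j _.
    by case/orP: (mupos j) => [/eqP//|/H].
  by apply: le_trans (qD _ _ (mulam _ mj) (mulam _ mj)); apply: enorm_ge0.
have up : \sum_i \sum_j mu i * mu j * dot (q i - q j) (q i - q j) <=
    D ^+ 2 * (1 - \sum_i mu i ^+ 2).
  have -> : 1 - \sum_i mu i ^+ 2 = \sum_i \sum_(j | j != i) mu i * mu j.
    rewrite -[1]mulr1 -{1}mu1 mulr_suml -sumrB; apply: eq_bigr => i _.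
    by rewrite -mulr_sumr -mu1 (bigD1 i)//= mulrDr -expr2 addrC addKr.
  rewrite mulr_sumr; apply: ler_sum => i _.
  rewrite (bigD1 i)//= subrr dot0l mulr0 add0r mulr_sumr; apply: ler_sum => j _.
  rewrite mulrC -sqr_enorm.
  case/orP: (mupos i) => [/eqP ->|mi]; first by rewrite !mul0r !mulr0.
  case/orP: (mupos j) => [/eqP ->|mj]; first by rewrite !mulr0.
  rewrite ler_pM2r ?mulr_gt0// lerXn2r ?nnegrE ?enorm_ge0//.
  by apply: qD; apply: mulam.
have n1 : 0 < n%:R + 1 :> R by rewrite ltr_wpDl.
(* The squared deviations of the weights from [1 / (n + 1)], summed over a support of at most
   [n + 1] points, are nonnegative. *)
have mu2 : 1 <= (n%:R + 1) * \sum_i mu i ^+ 2.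
  pose s : R := (n%:R + 1)^-1.
  have : 0 <= \sum_(i | mu i != 0) (mu i - s) ^+ 2 by apply: sumr_ge0 => i _; rewrite sqr_ge0.
  under eq_bigr do rewrite sqrrB.
  rewrite big_split sumrB /= sumr_const.
  rewrite (_ : \sum_(i | mu i != 0) mu i ^+ 2 = \sum_i mu i ^+ 2); last first.
    rewrite [RHS](bigID (fun i => mu i != 0)) /= [X in _ = _ + X]big1 ?addr0// => i.
    by rewrite negbK => /eqP ->; rewrite expr0n.
  rewrite sumrMnl -mulr_suml (_ : \sum_(i | mu i != 0) mu i = 1); last first.
    rewrite -mu1 [RHS](bigID (fun i => mu i != 0)) /= [X in _ = _ + X]big1 ?addr0// => i.
    by rewrite negbK => /eqP.
  move=> H; have {}H : 0 <= \sum_i mu i ^+ 2 - (1 * s) *+ 2 + s ^+ 2 *+ n.+1.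
    apply: (le_trans H); rewrite lerD2l; apply: ler_wpMn2l; first by rewrite sqr_ge0.
    exact: cmu.
  have sn : (n%:R + 1) * s = 1 by rewrite /s mulfV// gt_eqF.
  have : 0 <= (n%:R + 1) * (\sum_i mu i ^+ 2 - (1 * s) *+ 2 + s ^+ 2 *+ n.+1).
    by rewrite mulr_ge0// ltW.
  rewrite -[s ^+ 2 *+ _]mulr_natl -natr1.
  by set S := \sum_i _; nra.
have : (n%:R + 1) * (2 * r ^+ 2) <= (n%:R + 1) * (D ^+ 2 * (1 - \sum_i mu i ^+ 2)).
  by rewrite ler_pM2l// (le_trans lo up).
have : 0 <= D ^+ 2 by rewrite sqr_ge0.
move: mu2; set S := \sum_i _; set E := D ^+ 2 => mu2 E0.
have : 0 <= E * ((n%:R + 1) * S - 1) by rewrite mulr_ge0// subr_ge0.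
by lra.
Qed.
End Dot.

Lemma dot_le_enorm (R : realType) (n : nat) (x y : 'rV[R]_n) : dot x y <= enorm x * enorm y.
Proof.
rewrite /enorm -sqrtrM ?dot_ge0//; apply: (le_trans (ler_norm _)).
rewrite -sqrtr_sqr ler_sqrt ?mulr_ge0 ?dot_ge0//.
under [X in _ <= X * _]eq_bigr do rewrite -expr2.
under [X in _ <= _ * X]eq_bigr do rewrite -expr2.
exact: cauchy_schwarz_sum.
Qed.

(** * The regular simplex inscribed in the unit sphere *)

Section Simplex.
Variables (R : realType) (n : nat).
Hypothesis n_gt0 : (0 < n)%N.

(* Vertices of a regular simplex inscribed in the unit sphere: [None] is opposite
   to the main diagonal, [Some i] lies in the plane of the diagonal and the [i]-th axis. *)
Definition simplex_vertex (o : option 'I_n) : 'rV[R]_n :=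
  let c := (Num.sqrt n%:R)^-1 in
  let a := Num.sqrt ((n%:R + 1) / n%:R) in
  if o is Some i then a *: delta_mx ord0 i - ((a - c) / n%:R) *: const_mx 1
  else - c *: const_mx 1.

(** Here [c] makes the vertex [None] a unit vector, [a] is the edge length divided by the square
    root of 2, and [b] makes the vertices sum to zero. *)
Let c : R := (Num.sqrt n%:R)^-1.
Let a : R := Num.sqrt ((n%:R + 1) / n%:R).
Let b : R := (a - c) / n%:R.

Let nR_neq0 : n%:R != 0 :> R. Proof. by rewrite pnatr_eq0 -lt0n. Qed.

Let c2 : c ^+ 2 = n%:R^-1. Proof. by rewrite exprVn sqr_sqrtr ?ler0n. Qed.

Let a2 : a ^+ 2 = n%:R^-1 + 1.
Proof.
rewrite sqr_sqrtr ?divr_ge0 ?addr_ge0 ?ler0n ?ler01//.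
by rewrite mulrDl mulfV// mul1r addrC.
Qed.

Let dot_delta (i : 'I_n) (x : 'rV[R]_n) : dot (delta_mx ord0 i) x = x ord0 i.
Proof.
rewrite /dot (bigD1 i)//= big1 ?addr0; first by rewrite mxE !eqxx mul1r.
by move=> j ji; rewrite mxE (negbTE ji) andbF mul0r.
Qed.

Let dot_one : dot (const_mx 1) (const_mx 1 : 'rV[R]_n) = n%:R.
Proof.
rewrite /dot (eq_bigr (fun=> 1)) ?sumr_const ?card_ord// => i _.
by rewrite !mxE mulr1.
Qed.

Let dot_SomeSome i j :
  dot (simplex_vertex (Some i)) (simplex_vertex (Some j)) = (i == j)%:R * a ^+ 2 - n%:R^-1.
Proof.
rewrite /simplex_vertex -/a -/c -/b.
rewrite !(dotDl, dotDr, dotNl, dotNr, dotZl, dotZr) (dotC (const_mx 1) (delta_mx _ _)).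
rewrite !dot_delta dot_one !mxE eqxx /=.
have -> : n%:R^-1 = a ^+ 2 / n%:R - c ^+ 2 / n%:R by rewrite a2 c2; field.
by rewrite /b; field.
Qed.

Let dot_SomeNone i :
  dot (simplex_vertex (Some i)) (simplex_vertex None) = - n%:R^-1.
Proof.
rewrite /simplex_vertex -/a -/c -/b.
rewrite !(dotDl, dotDr, dotNl, dotNr, dotZl, dotZr).
rewrite !dot_delta dot_one !mxE -c2.
by rewrite /b; field.
Qed.

Let dot_NoneNone : dot (simplex_vertex None) (simplex_vertex None) = 1.
Proof.
rewrite /simplex_vertex -/c !(dotDl, dotDr, dotNl, dotNr, dotZl, dotZr) dot_one.
by rewrite mulrA mulrNN -expr2 c2 mulVf.
Qed.

Lemma dot_simplex_vertex o : dot (simplex_vertex o) (simplex_vertex o) = 1.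
Proof.
case: o => [i|]; last exact: dot_NoneNone.
by rewrite dot_SomeSome eqxx mul1r a2 addrAC subrr add0r.
Qed.

Lemma simplex_length_sqr : simplex_length R n ^+ 2 = 2 * (n%:R + 1) / n%:R.
Proof. by rewrite sqr_sqrtr// divr_ge0// mulr_ge0// addr_ge0. Qed.

(** The squared edge length is [2 + 2 / n], so for unit vectors it is enough that the inner products
    are at least [- 1 / n]. *)
Lemma enorm_simplex_vertexB o o' :
  enorm (simplex_vertex o - simplex_vertex o') <= simplex_length R n.
Proof.
rewrite ler_sqrt; last by rewrite divr_ge0// mulr_ge0// addr_ge0.
have -> : 2 * (n%:R + 1) / n%:R = 2 + 2 * n%:R^-1 :> R by field.
have n1 : 0 <= n%:R^-1 :> R by rewrite invr_ge0.
rewrite dot_subsub !dot_simplex_vertex.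
suff : - n%:R^-1 <= dot (simplex_vertex o) (simplex_vertex o') by lra.
case: o o' => [i|] [j|]; rewrite ?(dotC (simplex_vertex None) (simplex_vertex (Some _))).
- by rewrite dot_SomeSome addrC lerDl mulr_ge0 ?sqr_ge0.
- by rewrite dot_SomeNone.
- by rewrite dot_SomeNone.
- by rewrite dot_NoneNone; lra.
Qed.

(** The vertices sum to zero, so their inner products with [x] cannot all be negative. *)
Lemma simplex_vertex_halfspace (x : 'rV[R]_n) : exists o, 0 <= dot x (simplex_vertex o).
Proof.
apply: contrapT => H.
have H0 o : dot x (simplex_vertex o) < 0.
  by rewrite ltNge; apply/negP => ?; apply: H; exists o.
have E : simplex_vertex None + \sum_i simplex_vertex (Some i) = 0.
  rewrite /simplex_vertex -/a -/c -/b sumrB -scaler_sumr sumr_const card_ord.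
  have -> : \sum_i delta_mx ord0 i = const_mx 1 :> 'rV[R]_n.
    apply/rowP => j; rewrite summxE (bigD1 j)//= !mxE !eqxx big1 ?addr0// => k kj.
    by rewrite !mxE [j == k]eq_sym (negbTE kj) andbF.
  rewrite -scaler_nat scalerA -scalerBl -scalerDl (_ : _ + _ = 0) ?scale0r//.
  by rewrite /b; field.
have E2 : \sum_i dot x (simplex_vertex (Some i)) = - dot x (simplex_vertex None).
  by apply/eqP; rewrite -addr_eq0 addrC -dot_sumr -dotDr E dotC dot0l.
have : \sum_i dot x (simplex_vertex (Some i)) <= 0 by apply: sumr_le0 => j _; apply: ltW.
by rewrite E2 oppr_le0 leNgt H0.
Qed.

Lemma simplex_length_ge : 2 <= simplex_length R n ^+ 2.
Proof.
rewrite simplex_length_sqr.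
have -> : 2 * (n%:R + 1) / n%:R = 2 + 2 * n%:R^-1 :> R by field.
by rewrite lerDl mulr_ge0// invr_ge0.
Qed.

Lemma simplex_length_le : simplex_length R n <= 2.
Proof.
rewrite -(ler_pXn2r (n := 2))// ?nnegrE ?sqrtr_ge0// simplex_length_sqr.
rewrite ler_pdivrMr ?ltr0n//; have : 1 <= n%:R :> R by rewrite ler1n.
by lra.
Qed.
End Simplex.

(** * The upper bound *)

(** Radii [s > r] are used because the balls are open: [r] itself may fail to be admissible although
    it is the infimum. *)
Lemma hausdorff_dist_le (R : realType) (M : metricType R) (A B : set M) (r : R) : 0 <= r ->
  (forall s, r < s -> A `<=` \bigcup_(b in B) ball b s /\ B `<=` \bigcup_(a in A) ball a s) ->
  (hausdorff_dist A B <= r%:E)%E.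
Proof.
move=> r0 H; apply/lee_addgt0Pr => e e0.
apply: ereal_inf_lbound; exists (r + e); last by rewrite EFinD.
by split; [rewrite ltr_wpDl|apply: H; rewrite ltrDl].
Qed.

(** * Gluing two metric spaces along a map of bounded distortion *)

Section Glue.
Variables (R : realType) (X Y : metricType R) (f : X -> Y) (c : R).
Hypothesis c_gt0 : 0 < c.
Hypothesis f_dis : forall x x', `|mdist (f x) (f x') - mdist x x'| <= 2 * c.

(** The two proofs are parameters of the type so that the metric instance on it can depend on
    them. *)
Definition glue_of & 0 < c & (forall x x', `|mdist (f x) (f x') - mdist x x'| <= 2 * c) : Type :=
  (X + Y)%type.
Local Notation glue := (glue_of c_gt0 f_dis).

HB.instance Definition _ := Choice.copy glue (X + Y)%type.

(** Shortest way from [x] to [y] over a bridge of length [c] joining some [a] to [f a]. *)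
Definition glue_cross x y := inf (range (fun a => mdist x a + c + mdist (f a) y)).

Definition glue_dist (u v : glue) : R :=
  match u, v with
  | inl x, inl x' => mdist x x'
  | inr y, inr y' => mdist y y'
  | inl x, inr y | inr y, inl x => glue_cross x y
  end.

Let lb_cross x y m : (forall a, m <= mdist x a + c + mdist (f a) y) -> m <= glue_cross x y.
Proof.
move=> H; apply: lb_le_inf; first by exists (mdist x x + c + mdist (f x) y), x.
by move=> _ [a _ <-].
Qed.

Let cross_le x y a : glue_cross x y <= mdist x a + c + mdist (f a) y.
Proof.
apply: ge_inf; last by exists a.
by exists 0 => _ [b _ <-]; rewrite !addr_ge0 ?mdist_ge0 ?(ltW c_gt0).
Qed.

Let cross_ge x y : c <= glue_cross x y.
Proof. by apply: lb_cross => a; rewrite addrAC lerDr addr_ge0 ?mdist_ge0. Qed.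

Let fdis1 a b : mdist (f a) (f b) <= mdist a b + 2 * c.
Proof. by have := f_dis a b; rewrite ler_norml; lra. Qed.

Let fdis2 a b : mdist a b <= mdist (f a) (f b) + 2 * c.
Proof. by have := f_dis a b; rewrite ler_norml; lra. Qed.

(** A detour through the other space crosses two bridges, and their total length [2 * c] pays for
    the distortion of [f]. *)
Let cross_trX x x' y : mdist x x' <= glue_cross x y + glue_cross x' y.
Proof.
rewrite -lerBlDr; apply: lb_cross => a; rewrite lerBlDr -lerBlDl; apply: lb_cross => b.
have := fdis2 a b; have := metric_triangle (f a) y (f b); rewrite (metric_sym y (f b)).
have := metric_triangle x a x'; have := metric_triangle a b x'.
by rewrite (metric_sym b x'); lra.
Qed.

Let cross_trY x y y' : mdist y y' <= glue_cross x y + glue_cross x y'.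
Proof.
rewrite -lerBlDr; apply: lb_cross => a; rewrite lerBlDr -lerBlDl; apply: lb_cross => b.
have := fdis1 a b; have := metric_triangle a x b; rewrite (metric_sym a x).
have := metric_triangle y (f a) y'; have := metric_triangle (f a) (f b) y'.
by rewrite (metric_sym y (f a)); lra.
Qed.

Let cross_leX x x' y : glue_cross x y <= mdist x x' + glue_cross x' y.
Proof.
rewrite -lerBlDl; apply: lb_cross => a; rewrite lerBlDl.
by have := cross_le x y a; have := metric_triangle x x' a; lra.
Qed.

Let cross_leY x y y' : glue_cross x y <= glue_cross x y' + mdist y' y.
Proof.
rewrite -lerBlDr; apply: lb_cross => a; rewrite lerBlDr.
by have := cross_le x y a; have := metric_triangle (f a) y' y; lra.
Qed.

Let glue_distxx u : glue_dist u u = 0.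
Proof. by case: u => u /=; exact: mdistxx. Qed.

Let glue_dist_positivity u v : glue_dist u v = 0 -> u = v.
Proof.
case: u v => [x|y] [x'|y'] /=; try by move=> /mdist_positivity ->.
- by move=> E; have := cross_ge x y'; rewrite E leNgt c_gt0.
- by move=> E; have := cross_ge x' y; rewrite E leNgt c_gt0.
Qed.

Let glue_dist_sym u v : glue_dist u v = glue_dist v u.
Proof. by case: u v => [x|y] [x'|y'] //=; exact: metric_sym. Qed.

Let glue_dist_triangle v u w : glue_dist u w <= glue_dist u v + glue_dist v w.
Proof.
case: u v w => [x|y] [x'|y'] [x''|y''] //=; try exact: metric_triangle.
- by rewrite addrC (metric_sym x') cross_leX.
- by rewrite addrC (metric_sym y) cross_leY.
Qed.

HB.instance Definition _ := isMetric.Build R glue glue_distxx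
  glue_dist_positivity glue_dist_sym glue_dist_triangle.

(** In the glued space [x] and [f x] are within [c] of each other, and surjectivity gives every [y]
    such a partner. *)
Lemma gromov_hausdorff_dist_le :
  (forall y, exists x, f x = y) -> (gromov_hausdorff_dist X Y <= c%:E)%E.
Proof.
move=> fsurj.
apply: (@le_trans _ _ (hausdorff_dist (range (inl : X -> glue)) (range (inr : Y -> glue)))).
  by apply: ereal_inf_lbound; exists glue, inl, inr.
apply: hausdorff_dist_le => [|s cs]; first exact: ltW.
have cl x : glue_cross x (f x) < s.
  by apply: le_lt_trans cs; have := cross_le x (f x) x; rewrite !mdistxx addr0 add0r.
split=> [_ [x _ <-]|_ [y _ <-]].
  by exists (inr (f x)); [exists (f x)|rewrite ballEmdist /=; exact: cl].
have [x xy] := fsurj y.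
by exists (inl x); [exists x|rewrite ballEmdist /= -xy; exact: cl].
Qed.
End Glue.

Lemma dilate_ball_complP (R : realType) (n : nat) (eps : R) (x : euclid R n) : 0 < eps ->
  dilate eps (@ball_compl R n) x <-> eps <= enorm x.
Proof.
move=> e0; have blE (y : euclid R n) : ball_compl y <-> 1 <= enorm y.
  rewrite /ball_compl /setC /= ballEmdist /= [mdist _ _]euclid_distE sub0r enormN.
  by rewrite leNgt; split=> /negP.
split=> [[y /blE y1 <-]|ex].
  by rewrite enormZ gtr0_norm// ler_pMr.
exists (eps^-1 *: x); last by rewrite scalerA mulfV ?gt_eqF// scale1r.
by apply/blE; rewrite enormZ gtr0_norm ?invr_gt0// mulrC ler_pdivlMr// mul1r.
Qed.

(** * The map onto the complement of the unit ball and its distortion *)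

Section PushOut.
Variables (R : realType) (n : nat).
Hypothesis n_gt0 : (0 < n)%N.
Local Notation l := (simplex_length R n).
Implicit Types x y v w : 'rV[R]_n.

(** By [simplex_vertex_halfspace] an admissible vertex always exists, so [xget] never falls back on
    its default. *)
Definition push_out x : 'rV[R]_n :=
  if 1 <= enorm x then x
  else if l / 2 < enorm x then (enorm x)^-1 *: x
  else simplex_vertex R (xget None [set o | 0 <= dot x (simplex_vertex R o)]).

Let l0 : 0 <= l. Proof. exact: sqrtr_ge0. Qed.
Let l2 : 2 <= l ^+ 2. Proof. exact: simplex_length_ge. Qed.
Let lle : l <= 2. Proof. exact: simplex_length_le. Qed.
Let l1 : 1 <= l. Proof. by rewrite -(ler_pXn2r (n := 2))// ?nnegrE// expr1n; have := l2; lra. Qed.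

Let enorm_vertex (o : option 'I_n) : enorm (simplex_vertex R o) = 1.
Proof. by rewrite /enorm dot_simplex_vertex// sqrtr1. Qed.

Let enorm_le_l x : dot x x <= l ^+ 2 -> enorm x <= l.
Proof. by move=> H; rewrite -(ler_pXn2r (n := 2))// ?nnegrE ?enorm_ge0// sqr_enorm. Qed.

Inductive push_out_spec x : 'rV[R]_n -> Prop :=
| PushOutFar of 1 <= enorm x : push_out_spec x x
| PushOutMid w r of enorm w = 1 & l / 2 <= r & r <= 1 & x = r *: w : push_out_spec x w
| PushOutNear v of enorm x <= l / 2 & enorm v = 1 & 0 <= dot x v
   & (exists o, v = simplex_vertex R o) : push_out_spec x v.

Lemma push_outP x : push_out_spec x (push_out x).
Proof.
rewrite /push_out; case: (leP 1 (enorm x)) => [|x1]; first exact: PushOutFar.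
case: (ltP (l / 2) (enorm x)) => [lx|xl].
  have x0 : 0 < enorm x by apply: le_lt_trans lx; rewrite divr_ge0.
  apply: (@PushOutMid _ _ (enorm x)); rewrite ?ltW//.
    by rewrite enormZ gtr0_norm ?invr_gt0// mulVf ?gt_eqF.
  by rewrite scalerA mulfV ?gt_eqF// scale1r.
have [k ox] := simplex_vertex_halfspace n_gt0 x.
case: xgetP => [k' _ ox'|/(_ k)//].
by apply: PushOutNear; rewrite ?enorm_vertex//; exists k'.
Qed.

Lemma push_out_ge1 x : 1 <= enorm (push_out x).
Proof. by case: push_outP => // [w r ->|v _ ->]. Qed.

Lemma push_out_id x : 1 <= enorm x -> push_out x = x.
Proof. by rewrite /push_out => ->. Qed.

(** Displacements of the two points add up. This settles every pair of cases except middle with near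
    and near with near. *)
Let dis_close x y w w' a b :
  enorm (w - x) <= a -> enorm (w' - y) <= b -> a + b <= l ->
  `|enorm (w - w') - enorm (x - y)| <= l.
Proof.
have ? := l1; have ? := l2; have ? := lle.
move=> wx wy abl.
have := enormB_triangle x w w'; have := enormB_triangle y x w'.
have := enormB_triangle w x y; have := enormB_triangle w' w y.
rewrite (enormB x w) (enormB y w') ler_norml.
by move=> h1 h2 h3 h4; apply/andP; split; lra.
Qed.

(** The squared distance is at most [1 + l ^+ 2 / 4], which [2 <= l ^+ 2] bounds by [l ^+ 2]. *)
Let near_vertex x v : enorm x <= l / 2 -> enorm v = 1 -> 0 <= dot x v -> enorm (v - x) <= l.
Proof.
have ? := l1; have ? := l2; have ? := lle.
move=> xl v1 xv; apply: enorm_le_l.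
rewrite dot_subsub (dotC v) -!sqr_enorm v1.
have : enorm x ^+ 2 <= (l / 2) ^+ 2 by rewrite lerXn2r ?nnegrE ?enorm_ge0 ?divr_ge0.
by nra.
Qed.

Let mid_close w (r : R) : enorm w = 1 -> l / 2 <= r -> r <= 1 -> enorm (w - r *: w) <= 1 - l / 2.
Proof.
have ? := l1; have ? := l2; have ? := lle.
move=> w1 lr r1; rewrite -{1}[w]scale1r -scalerBl enormZ w1 mulr1 ger0_norm ?subr_ge0//.
by lra.
Qed.

(** The displacement bounds [1 - l / 2] and [l] add up to more than [l] unless [l = 2], so each
    inequality gets its own argument. The first passes through [r *: v]; the second is delicate only
    when [w] and [v] form an obtuse angle. *)
Let mid_near (r : R) w v y : enorm w = 1 -> l / 2 <= r -> r <= 1 ->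
  enorm y <= l / 2 -> enorm v = 1 -> 0 <= dot y v ->
  `|enorm (w - v) - enorm (r *: w - y)| <= l.
Proof.
have ? := l1; have ? := l2; have ? := lle.
move=> w1 lr r1 yl v1 yv; rewrite ler_norml; apply/andP; split.
  have := enormB_triangle (r *: v) (r *: w) y.
  have : enorm (r *: w - r *: v) <= enorm (w - v).
    rewrite -scalerBr enormZ ger0_norm; last by lra.
    by rewrite ler_piMl ?enorm_ge0.
  have : enorm (r *: v - y) <= l.
    apply: enorm_le_l; rewrite dot_subsub !dotZl !dotZr (dotC v) -!sqr_enorm v1.
    have : enorm y ^+ 2 <= (l / 2) ^+ 2 by rewrite lerXn2r ?nnegrE ?enorm_ge0 ?divr_ge0.
    have r0 : 0 <= r by lra.
    have := mulr_ge0 r0 yv; nra.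
  by lra.
have [wv|wv] := leP 0 (dot w v).
  have : enorm (w - v) <= l.
    by apply: enorm_le_l; rewrite dot_subsub -!sqr_enorm w1 v1; lra.
  by have := enorm_ge0 (r *: w - y); lra.
(* [s = - <w,v>] bounds the distance from [r w] to the half-space of [v] below by [r s]. *)
set s := - dot w v; have s0 : 0 < s by rewrite oppr_gt0.
have rs : r * s <= enorm (r *: w - y).
  have := dot_le_enorm (y - r *: w) v; rewrite v1 mulr1 enormB dotDl dotNl dotZl.
  by rewrite /s; lra.
have ls : l / 2 * s <= r * s by rewrite ler_pM2r.
(* Squared, this compares [2 + 2 * s] with a square that is at least [l ^+ 2 * (1 + s)]. *)
suff : enorm (w - v) <= l + l / 2 * s by lra.
have ls0 : 0 <= l / 2 * s by rewrite mulr_ge0// ?divr_ge0// ltW.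
rewrite -(ler_pXn2r (n := 2))// ?nnegrE ?enorm_ge0 ?addr_ge0//.
rewrite sqr_enorm dot_subsub -!sqr_enorm w1 v1.
have := sqr_ge0 (l / 2 * s).
have : 0 <= (l ^+ 2 - 2) * s by rewrite mulr_ge0 ?subr_ge0// ltW.
have -> : dot w v = - s by rewrite opprK.
move: l2; rewrite expr1n; clearbody s; nra.
Qed.

Lemma push_out_distortion x y :
  `|enorm (push_out x - push_out y) - enorm (x - y)| <= l.
Proof.
have ? := l1; have ? := l2; have ? := lle.
have e0 (z : 'rV[R]_n) : enorm (z - z) <= 0 by rewrite subrr enorm0.
case: (push_outP x) => [x1|w r w1 lr r1 ->|v xl v1 xv [k vo]];
  case: (push_outP y) => [y1|w' r' w1' lr' r1' ->|v' yl v1' yv [k' vo']].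
- by apply: (dis_close (e0 x) (e0 y)); rewrite addr0.
- by apply: (dis_close (e0 _) (mid_close w1' lr' r1')); lra.
- by apply: (dis_close (e0 _) (near_vertex yl v1' yv)); lra.
- by apply: (dis_close (mid_close w1 lr r1) (e0 _)); lra.
- by apply: (dis_close (mid_close w1 lr r1) (mid_close w1' lr' r1')); lra.
- exact: mid_near.
- by apply: (dis_close (near_vertex xl v1 xv) (e0 _)); lra.
- by rewrite enormB [enorm (x - _)]enormB; apply: mid_near.
(* Both distances lie between 0 and [l]: the images are simplex vertices, and the points have norm
   at most [l / 2]. *)
- have := enorm_ge0 (v - v'); have := enorm_ge0 (x - y).
  have : enorm (v - v') <= l by rewrite vo vo'; apply: enorm_simplex_vertexB.
  have := enormB_triangle 0 x y; rewrite subr0 sub0r enormN ler_norml => h1 h2 h3 h4.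
  by apply/andP; split; lra.
Qed.
End PushOut.

Lemma gromov_hausdorff_ball_compl_le (R : realType) (n : nat) (eps : R) :
  (0 < n)%N -> 0 < eps ->
  (gromov_hausdorff_dist (euclid R n) (submetric (dilate eps (@ball_compl R n)))
    <= (eps * (simplex_length R n / 2))%:E)%E.
Proof.
move=> n0 e0; set A := dilate _ _.
have l0 : 0 < simplex_length R n.
  rewrite lt_neqAle sqrtr_ge0 andbT; apply: contraTneq (simplex_length_ge R n0) => <-.
  by rewrite expr0n/= lern0.
(* Conjugating [push_out] by the dilation scales its distortion by [eps]. [F] fixes [A] pointwise,
   hence is onto. *)
pose F (x : euclid R n) : euclid R n := eps *: push_out (eps^-1 *: (x : 'rV[R]_n)).
have FA x : F x \in A.
  apply/mem_set/dilate_ball_complP => //.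
  by rewrite enormZ gtr0_norm// ler_pMr// push_out_ge1.
have Fid x : A x -> F x = x.
  move=> /(dilate_ball_complP _ e0) ex; rewrite /F push_out_id.
    by rewrite scalerA mulfV ?gt_eqF// scale1r.
  by rewrite enormZ gtr0_norm ?invr_gt0// mulrC ler_pdivlMr// mul1r.
pose f (x : euclid R n) : submetric A := SigSub (FA x).
apply: (@gromov_hausdorff_dist_le _ _ _ f).
- by rewrite mulr_gt0 ?divr_gt0.
- move=> x y; rewrite [mdist (f x) _]euclid_distE [mdist x y]euclid_distE /= /F.
  rewrite -scalerBr enormZ (gtr0_norm e0).
  have -> : enorm ((x : 'rV[R]_n) - y) =
      eps * enorm (eps^-1 *: (x : 'rV[R]_n) - eps^-1 *: (y : 'rV[R]_n)).
    by rewrite -scalerBr enormZ gtr0_norm ?invr_gt0// mulrA mulfV ?gt_eqF// mul1r.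
  rewrite -mulrBr normrM (gtr0_norm e0).
  have -> : 2 * (eps * (simplex_length R n / 2)) = eps * simplex_length R n by field.
  by rewrite ler_pM2l//; apply: push_out_distortion.
- move=> [y yA]; exists y; apply: val_inj; rewrite /=; apply: Fid.
  exact: set_mem.
Qed.

(** The origin forces every admissible radius above [eps]; conversely, points of the ball move
    radially to the sphere of radius [eps]. *)
Lemma hausdorff_dist_ball_compl (R : realType) (n : nat) (eps : R) :
  (0 < n)%N -> 0 < eps ->
  hausdorff_dist [set: euclid R n] (dilate eps (@ball_compl R n)) = eps%:E.
Proof.
move=> n0 e0; apply/eqP; rewrite eq_le; apply/andP; split; last first.
  apply: le_ereal_inf_tmp => _ [r [_ [H _]] <-].
  have [b /(dilate_ball_complP _ e0) eb] := H (0 : 'rV[R]_n) I.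
  rewrite ballEmdist /= [mdist _ _]euclid_distE subr0 lee_fin => br.
  exact: (ltW (le_lt_trans eb br)).
apply: hausdorff_dist_le => [|s es]; first exact: ltW.
split=> [x _|x _]; last first.
  by exists x => //; rewrite ballEmdist /= mdistxx (lt_trans e0).
have [ex|xe] := leP eps (enorm (x : 'rV[R]_n)).
  exists x; first exact/dilate_ball_complP.
  by rewrite ballEmdist /= mdistxx (lt_trans e0).
(* The origin has no radial direction; a coordinate vector, available since [0 < n], replaces it. *)
have [x0|x0] := eqVneq (enorm x) 0.
  have d1 : enorm (delta_mx ord0 (Ordinal n0) : 'rV[R]_n) = 1.
    rewrite /enorm /dot (bigD1 (Ordinal n0))//= !mxE !eqxx mulr1 big1 ?addr0 ?sqrtr1// => j jn.
    by rewrite !mxE (negbTE jn) andbF mul0r.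
  exists (eps *: delta_mx ord0 (Ordinal n0)).
    by apply/dilate_ball_complP => //; rewrite enormZ d1 mulr1 ger0_norm// ltW.
  rewrite ballEmdist /= [mdist _ _]euclid_distE (enorm_eq0 x0) subr0.
  by rewrite enormZ d1 mulr1 gtr0_norm.
have {}x0 : 0 < enorm x by rewrite lt_neqAle eq_sym x0 enorm_ge0.
exists ((eps / enorm x) *: x).
  apply/dilate_ball_complP => //; rewrite enormZ gtr0_norm ?divr_gt0//.
  by rewrite divfK ?gt_eqF.
rewrite ballEmdist /= [mdist _ _]euclid_distE -[X in _ - X]scale1r -scalerBl enormZ.
have e1 : 1 <= eps / enorm x by rewrite ler_pdivlMr// mul1r ltW.
rewrite ger0_norm ?subr_ge0// mulrBl divfK ?gt_eqF// mul1r.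
by lra.
Qed.

(** * The lower bound *)

Lemma continuous_sum_at (R : realType) (n : nat) (V : normedModType R) (J : finType)
    (F : J -> 'rV[R]_n -> V) (x : 'rV[R]_n) :
  (forall j, {for x, continuous (F j)}) -> {for x, continuous (fun y => \sum_j F j y)}.
Proof.
move=> Fc; apply: (@cvg_big V J +%R 0 predT _ _ (nbhs x)); first exact: add_continuous.
by move=> j _; exact: Fc.
Qed.

Lemma enorm_continuous (R : realType) (n : nat) : continuous (@enorm R n).
Proof.
move=> x; apply: (@continuous_comp _ _ _ (fun y : 'rV[R]_n => dot y y) Num.sqrt).
  apply: (@continuous_sum_at R n R^o) => i.
  by apply: continuousM; apply: coord_continuous.
exact: sqrt_continuous.
Qed.

Lemma finite_net (R : realType) (n : nat) (L d : R) : 0 < d ->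
  exists (J : finType) (p : J -> 'rV[R]_n),
    forall x : 'rV[R]_n, (forall i, `|x ord0 i| <= L) -> exists j, enorm (p j - x) < d.
Proof.
(* A grid of mesh [h] comes within [n * h] of each point of the cube; dividing by [n.+1] makes this
   strictly less than [d]. *)
move=> d0; pose h := d / n.+1%:R; have h0 : 0 < h by rewrite divr_gt0.
pose K := (Num.truncn (2 * L / h)).+1.
exists {ffun 'I_n -> 'I_K}, (fun u : {ffun 'I_n -> 'I_K} => \row_i (- L + (u i)%:R * h)) => x xL.
have xb i : 0 <= (x ord0 i + L) / h <= 2 * L / h.
  have := xL i; rewrite ler_norml => /andP[x1 x2].
  by rewrite divr_ge0 ?ler_pM2r ?invr_gt0 ?(ltW h0)//=; lra.
have uK i : (Num.truncn ((x ord0 i + L) / h) < K)%N.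
  by rewrite ltnS le_truncn//; case/andP: (xb i).
exists [ffun i => Ordinal (uK i)].
apply: (@le_lt_trans _ _ (n%:R * h)); last first.
  by rewrite /h mulrCA gtr_pMr// ltr_pdivrMr// mul1r ltr_nat.
apply: enorm_le_coord => i; rewrite !mxE ffunE /=.
have /truncn_itv/andP[t1 t2] : 0 <= (x ord0 i + L) / h by case/andP: (xb i).
set t := (Num.truncn _)%:R in t1 *; rewrite ler_pdivlMr// in t1.
move: t2; rewrite -natr1 -/t ltr_pdivrMr// mulrDl mul1r => t2.
by rewrite ler_norml; apply/andP; split; lra.
Qed.

(* Averaging a possibly discontinuous [f] over a fine net gives a continuous map whose
   value at [x] is a convex combination of values of [f] near [x]. *)
Lemma continuous_smoothing (R : realType) (n : nat) (f : 'rV[R]_n -> 'rV[R]_n) (L d : R) :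
  0 < d -> exists (F : 'rV[R]_n -> 'rV[R]_n) (J : finType) (p : J -> 'rV[R]_n)
    (lam : 'rV[R]_n -> J -> R), forall x : 'rV[R]_n, (forall i, `|x ord0 i| <= L) ->
  [/\ {for x, continuous F}, forall j, 0 <= lam x j, \sum_j lam x j = 1,
    forall j, 0 < lam x j -> enorm (p j - x) <= d &
    F x = \sum_j lam x j *: f (p j)].
Proof.
move=> d0; have [J [p pP]] := finite_net n L d0.
pose a j (x : 'rV[R]_n) : R := d - enorm (p j - x).
(* Twice the positive part of [a j]: a continuous bump supported in the ball of radius [d] about
   [p j]. The net makes the sum [S] positive on the cube. *)
pose w j (x : 'rV[R]_n) : R := `|a j x| + a j x.
pose S (x : 'rV[R]_n) : R := \sum_j w j x.
have w0 j x : 0 <= w j x by rewrite /w -lerBlDr sub0r -normrN ler_norm.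
exists (fun x => \sum_j (w j x / S x) *: f (p j)), J, p, (fun x j => w j x / S x) => x xL.
have S0 : 0 < S x.
  have [j pj] := pP x xL; rewrite /S (bigD1 j)//= ltr_wpDr//; first exact: sumr_ge0.
  by rewrite /w ltr_wpDl// /a subr_gt0.
split=> //.
- have ac j : {for x, continuous (a j)}.
    apply: continuousB; first exact: cst_continuous.
    apply: (@continuous_comp _ _ _ (fun y : 'rV[R]_n => p j - y) (@enorm R n));
      last exact: enorm_continuous.
    by apply: continuousB; [exact: cst_continuous|exact: cvg_id].
  have wc j : {for x, continuous (w j)}.
    apply: continuousD (ac j).
    by apply: (@continuous_comp _ _ _ (a j) Num.norm) (ac j) _; exact: norm_continuous.
  apply: continuous_sum_at => j.
  apply: (@cvgZr_tmp _ _ _ (nbhs x)); apply: (@cvgM _ _ (nbhs x) _ _ _ _ _ (wc j)).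
  apply: (@cvgV _ _ (nbhs x)); first by rewrite gt_eqF.
  exact: (@continuous_sum_at R n R^o).
- by move=> j; rewrite divr_ge0// ltW.
- by rewrite -mulr_suml mulfV// gt_eqF.
- move=> j; rewrite pmulr_lgt0 ?invr_gt0// /w => wj.
  rewrite leNgt; apply/negP => dj; move: wj.
  by rewrite ltr0_norm ?addNr ?ltxx// /a subr_lt0.
Qed.

(** The lower bound freed of the ambient space: only coarse estimates on [f] and [g] remain, and [g]
    is controlled only at points of norm at least [eps]. *)
Lemma coarse_retract_bound (R : realType) (n : nat) (eps r : R) (f g : 'rV[R]_n -> 'rV[R]_n) :
  (0 < n)%N -> 0 < eps ->
  (forall x, eps <= enorm (f x)) ->
  (forall x x', enorm (f x - f x') <= enorm (x - x') + 2 * r) ->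
  (forall y y', eps <= enorm y -> eps <= enorm y' ->
    enorm (g y - g y') <= enorm (y - y') + 2 * r) ->
  (forall y, eps <= enorm y -> enorm (f (g y) - y) <= 2 * r) ->
  eps * simplex_length R n <= 2 * r.
Proof.
move=> n0 e0 feps flip glip fg; set l := simplex_length R n.
rewrite leNgt; apply/negP => rl.
have r0 : 0 <= 2 * r by have := flip 0 0; rewrite !subrr enorm0 add0r.
(* A third of the slack: two net points within [d] of a common point have [f]-values at most
   [2 * d + 2 * r] apart, still less than [eps * l]. *)
pose d := (eps * l - 2 * r) / 3; have d0 : 0 < d by rewrite divr_gt0// subr_gt0.
pose a0 := eps *: simplex_vertex R (@None 'I_n).
have a0e : enorm a0 = eps.
  by rewrite enormZ /enorm dot_simplex_vertex// sqrtr1 mulr1 gtr0_norm.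
(* Sending the small ball to the single point [a0] makes [g \o a] controlled everywhere, at the cost
   of moving points by at most [2 * eps]. *)
pose a (p : 'rV[R]_n) := if eps <= enorm p then p else a0.
have ae p : eps <= enorm (a p) by rewrite /a; case: ifP => //; rewrite a0e.
have ap p : enorm (a p - p) <= 2 * eps.
  rewrite /a; case: (leP eps (enorm p)) => [_|/ltW pe].
    by rewrite subrr enorm0 mulr_ge0// ltW.
  by have := enormB_triangle 0 a0 p; rewrite subr0 sub0r enormN a0e; lra.
(* The total of the errors collected in [HC]. It bounds the displacement of [F \o G] and is also the
   half-side of the cube, which yields the boundary signs. The net for [G] may be coarse; radius 1
   suffices. *)
pose C := 6 * eps + d + 6 * r + 3.
have C0 : 0 < C by rewrite /C; lra.
have [G [J [p [lam GP]]]] := continuous_smoothing (g \o a) C ltr01.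
(* A bound for the values of [G] on the cube, so that the net for [F] can be laid over all of
   them. *)
pose L := \sum_j enorm (g (a (p j))).
have GL (x : 'rV[R]_n) : (forall i, `|x ord0 i| <= C) -> forall i, `|G x ord0 i| <= L.
  move=> xC i; have [_ lam0 lam1 _ GE] := GP x xC.
  apply: (le_trans (coord_le_enorm _ _)); rewrite GE -[X in enorm X]subr0.
  apply: enorm_convex => // j _; rewrite subr0 /L (bigD1 j)//= lerDl.
  by apply: sumr_ge0 => k _; exact: enorm_ge0.
have [F [J' [q [mu FP]]]] := continuous_smoothing f L d0.
have HC (x : 'rV[R]_n) : (forall i, `|x ord0 i| <= C) -> enorm (F (G x) - x) <= C.
  move=> xC; have [_ lam0 lam1 lamp GE] := GP x xC.
  have [_ mu0 mu1 muq FE] := FP _ (GL x xC).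
  have [j lamj] : exists j, 0 < lam x j.
    apply/not_existsP => H; have := oner_neq0 R; rewrite -lam1 big1 ?eqxx// => j _.
    by apply/eqP; rewrite eq_le lam0 andbT leNgt; apply/negP/H.
  have Gg : enorm (G x - g (a (p j))) <= 4 * eps + 2 + 2 * r.
    rewrite GE; apply: enorm_convex => // k lamk /=.
    apply: (le_trans (glip _ _ (ae _) (ae _))); rewrite lerD2r.
    have := enormB_triangle (p k) (a (p k)) (a (p j)); have := ap (p k).
    have := enormB_triangle (p j) (p k) (a (p j)); have := ap (p j).
    have := enormB_triangle x (p k) (p j); have := lamp _ lamj; have := lamp _ lamk.
    by rewrite (enormB (p j) x) (enormB (p j) (a _)); lra.
  have Ff : enorm (F (G x) - f (g (a (p j)))) <= d + (4 * eps + 2 + 2 * r) + 2 * r.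
    rewrite FE; apply: enorm_convex => // k muk.
    apply: (le_trans (flip _ _)); rewrite lerD2r.
    by have := enormB_triangle (G x) (q k) (g (a (p j))); have := muq _ muk; lra.
  have := enormB_triangle (f (g (a (p j)))) (F (G x)) x.
  have := enormB_triangle (a (p j)) (f (g (a (p j)))) x; have := fg _ (ae (p j)).
  have := enormB_triangle (p j) (a (p j)) x; have := ap (p j); have := lamp _ lamj.
  by rewrite /C; lra.
have Hi (x : 'rV[R]_n) i : (forall i, `|x ord0 i| <= C) -> `|F (G x) ord0 i - x ord0 i| <= C.
  move=> xC; apply: le_trans (HC x xC).
  by have := coord_le_enorm (F (G x) - x) i; rewrite !mxE.
have [||x i xC xi|x i xC xi|x xC FG0] := @poincare_miranda R n (F \o G) C.
- exact: C0.
- move=> x xC; apply: continuous_comp; first by have [] := GP x xC.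
  by have [] := FP _ (GL x xC).
- by have := Hi x i xC; rewrite xi ler_norml /=; lra.
- by have := Hi x i xC; rewrite xi ler_norml /=; lra.
have [_ mu0 mu1 muq] := FP _ (GL x xC); rewrite /= in FG0; rewrite FG0 => FE.
(* At the zero of [F \o G] the origin is a convex combination of values of [f], all of norm at least
   [eps] and too close together for Jung's inequality. *)
have := jung (D := 2 * d + 2 * r) (ltW e0) mu0 mu1 (esym FE) (fun j _ => feps _).
move=> /(_ _)/wrap[].
  move=> j k muj muk; apply: (le_trans (flip _ _)); rewrite lerD2r.
  have := enormB_triangle (G x) (q j) (q k); have := muq _ muj; have := muq _ muk.
  by rewrite (enormB (G x)); lra.
apply/negP; rewrite -ltNge.
have nR : 0 < n%:R :> R by rewrite ltr0n.
have -> : 2 * (n%:R + 1) * eps ^+ 2 = n%:R * (eps * l) ^+ 2.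
  by rewrite exprMn /l simplex_length_sqr; field; rewrite gt_eqF.
rewrite ltr_pM2l// ltrXn2r//; first by lra.
by rewrite /d; lra.
Qed.

Lemma gromov_hausdorff_ball_compl_ge (R : realType) (n : nat) (eps : R) :
  (0 < n)%N -> 0 < eps ->
  ((eps * (simplex_length R n / 2))%:E <=
   gromov_hausdorff_dist (euclid R n) (submetric (dilate eps (@ball_compl R n))))%E.
Proof.
move=> n0 e0; set A := dilate _ _.
apply: le_ereal_inf_tmp => _ [Z [i [j [iI jI ->]]]].
apply: le_ereal_inf_tmp => _ [r [r0 [ij ji]] <-]; rewrite lee_fin.
rewrite mulrA ler_pdivrMr// (mulrC r).
have /choice[f fP] : forall x : euclid R n, exists y : submetric A, mdist (i x) (j y) < r.
  move=> x; have [|_ [y _ <-]] := ij (i x); first by exists x.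
  by rewrite ballEmdist /= metric_sym; exists y.
(* Quantifying over the membership proof makes [g] a map on the whole space, with arbitrary values
   outside [A]. *)
have /choice[g gP] : forall y : euclid R n, exists x : euclid R n,
    forall yA : y \in A, mdist (i x) (j (SigSub yA)) < r.
  move=> y; have [yA|yA] := pselect (is_true (y \in A)); last by exists y => yA'; case: (yA yA').
  have [|_ [x _ <-]] := ji (j (SigSub yA)); first by exists (SigSub yA).
  rewrite ballEmdist /= => xy; exists x => yA'.
  by rewrite (bool_irrelevance yA' yA).
have inA (y : 'rV[R]_n) : eps <= enorm y -> (y : euclid R n) \in A.
  by move=> ey; apply/mem_set/dilate_ball_complP.
have dE (x y : euclid R n) : mdist (i x) (i y) = enorm ((x : 'rV[R]_n) - y).
  by rewrite iI [LHS]euclid_distE.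
have dA (x y : submetric A) : mdist (j x) (j y) = enorm ((val x : 'rV[R]_n) - val y).
  by rewrite jI [LHS]euclid_distE.
apply: (@coarse_retract_bound R n eps r (fun x => val (f x)) g) => //.
- by move=> x; apply/dilate_ball_complP => //; apply: set_mem (valP (f x)).
- move=> x x'; rewrite -dA -dE.
  have := metric_triangle (j (f x)) (i x) (j (f x')).
  have := metric_triangle (i x) (i x') (j (f x')).
  by have := fP x; have := fP x'; rewrite (metric_sym (j (f x)) (i x)); lra.
- move=> y y' /inA yA /inA yA'.
  have -> : enorm (y - y') = mdist (j (SigSub yA)) (j (SigSub yA')) by rewrite dA.
  rewrite -dE.
  have := metric_triangle (i (g y)) (j (SigSub yA)) (i (g y')).
  have := metric_triangle (j (SigSub yA)) (j (SigSub yA')) (i (g y')).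
  have := gP _ yA; have := gP _ yA'; rewrite (metric_sym (j (SigSub yA')) (i (g y'))); lra.
- move=> y /inA yA.
  have -> : enorm (val (f (g y)) - y) = mdist (j (f (g y))) (j (SigSub yA)) by rewrite dA.
  have := metric_triangle (j (f (g y))) (i (g y)) (j (SigSub yA)).
  by have := gP _ yA; have := fP (g y); rewrite (metric_sym (j (f (g y))) (i (g y))); lra.
Qed.

Theorem corollary3p4 (R : realType) (n : nat) (hn : (1 <= n)%N)
    (eps : R) (heps : 0 < eps) :
  gromov_hausdorff_dist (euclid R n) (submetric (dilate eps (@ball_compl R n)))
    = ((simplex_length R n / 2)%:E *
        hausdorff_dist [set: euclid R n] (dilate eps (@ball_compl R n)))%E
  /\ (hausdorff_dist [set: euclid R n] (dilate eps (@ball_compl R n))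
        <= eps%:E)%E.
Proof.
rewrite hausdorff_dist_ball_compl//; split=> //.
rewrite -EFinM mulrC; apply/eqP; rewrite eq_le.
by rewrite gromov_hausdorff_ball_compl_le// gromov_hausdorff_ball_compl_ge.
Qed.
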